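(* Let $T$ be an absolutely continuous contraction on a complex separable Hilbert space such that $\mu(T)<\infty$ and $T$ is similar to an isometry. Then $$\sup_{\lambda\in\mathbb D}\|I-b_\lambda(T)^\ast b_\lambda(T)\|_{\mathfrak S_1}<\infty .$$
   Context: All Hilbert spaces are complex and separable, and operators are linear and bounded. $\mathbb D$ is the open unit disk. A contraction is an operator $T$ with $\|T\|\le 1$. Every contraction decomposes uniquely as an orthogonal sum $T=T_1\oplus U_{(a)}\oplus U_{(s)}$, where $T_1$ is completely nonunitary (it has no nonzero reducing subspace on which it is unitary), and $U_{(a)}$, $U_{(s)}$ are unitary operators that are absolutely continuous, respectively singular, with respect to Lebesgue measure on the unit circle (in the sense of their spectral measures). $T$ is called absolutely continuous if the summand $U_{(s)}$ acts on the zero space. The multiplicity of an operator $T$ on $\mathcal H$ is $\mu(T)=\min\{\dim E: E\subset\mathcal H \text{ a subspace},\ \bigvee_{n=0}^\infty T^nE=\mathcal H\}$, where $\bigvee$ denotes closed linear span. Operators $T_1$ on $\mathcal H_1$ and $T_2$ on $\mathcal H_2$ are similar if there is a bounded invertible linear $X:\mathcal H_1\to\mathcal H_2$ with $XT_1=T_2X$. For $\lambda\in\mathbb D$ and a contraction $T$, $b_\lambda(z)=\frac{z-\lambda}{1-\overline\lambda z}$ and $b_\lambda(T)=(T-\lambda I)(I-\overline\lambda T)^{-1}$, which is again a contraction. $\mathfrak S_1$ is the trace class of operators and $\|\cdot\|_{\mathfrak S_1}$ its norm (with value $\infty$ for operators not in the trace class). *)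

(* Defs.v *)
From mathcomp Require Import all_boot all_order all_algebra.
From mathcomp Require Import sesquilinear complex.
From mathcomp Require Import all_classical all_reals all_analysis.

Set Implicit Arguments.
Unset Strict Implicit.
Unset Printing Implicit Defensive.

Import Order.TTheory GRing.Theory Num.Theory.
Import numFieldNormedType.Exports.

Local Open Scope classical_set_scope.
Local Open Scope complex_scope.
Local Open Scope ring_scope.

(* The inner product is linear in its first argument and conjugate-linear in
   the second. The zero space is allowed. *)
Record hilbertType (R : realType) := HilbertType {
  hilbert_space :> completeNormedModType R[i];
  hdot : {dot hilbert_space for Num.conj};
  hdot_norm : forall x : hilbert_space, `|x| ^+ 2 = hdot x x;
  hilbert_separable : exists D : set hilbert_space, countable D /\ dense D
}.

Section Operators.
Context {R : realType} {H : hilbertType R}.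
Implicit Types (A K : set H) (T P : H -> H).

Definition linear_subspace K :=
  K 0 /\ forall (a : R[i]) (x y : H), K x -> K y -> K (a *: x + y).

Definition closed_subspace K := linear_subspace K /\ closed K.

Definition closed_span A : set H := smallest closed_subspace A.

(* The adjoint; for a bounded operator T the vector z exists (Riesz) and is
   unique. *)
Definition adjoint T : H -> H := fun y =>
  xget 0 [set z : H | forall x : H, hdot H (T x) y = hdot H x z].

(* The two-sided inverse whenever T is bijective. *)
Definition op_inverse T : H -> H := fun y => xget 0 [set x : H | T x = y].

Definition positive_op P := forall x : H, 0 <= hdot H (P x) x.

Definition contraction_op T := forall x : H, `|T x| <= `|x|.

Definition moebius T (l : R[i]) : H -> H := fun x =>
  let y := op_inverse (fun z : H => z - l^* *: T z) x in T y - l *: y.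

(* I - T^* T *)
Definition defect T : H -> H := fun x => x - adjoint T (T x).

(* Multiplicity, with value +oo when no finite-dimensional E is cyclic. *)

Definition has_dim (E : set H) (n : nat) := exists v : 'I_n -> H,
  (forall c : 'I_n -> R[i],
      \sum_(i < n) c i *: v i = 0 -> forall i, c i = 0) /\
  E = [set x : H | exists c : 'I_n -> R[i], x = \sum_(i < n) c i *: v i].

Definition dimension (E : set H) : \bar R :=
  ereal_inf [set n%:R%:E | n in has_dim E].

Definition cyclic_subspace T (E : set H) :=
  closed_span (\bigcup_(n in [set: nat]) iter n T @` E) = setT.

Definition op_multiplicity T : \bar R :=
  ereal_inf
    [set dimension E | E in [set E | linear_subspace E /\ cyclic_subspace T E]].

(* Trace class norm: the trace of |T| = (T^* T)^(1/2), which does not depend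
   on the orthonormal basis, and is +oo if T is not trace class. *)

Definition orthonormal_basis A :=
  [/\ forall e : H, A e -> `|e| = 1,
      forall e f : H, A e -> A f -> e <> f -> hdot H e f = 0
    & closed_span A = setT].

Definition abs_op T : H -> H :=
  xget (fun=> 0) [set P : H -> H |
    [/\ linear P, continuous P, positive_op P
      & forall x : H, P (P x) = adjoint T (T x)]].

Definition trace_norm T : \bar R :=
  (\esum_(e in xget set0 orthonormal_basis)
     (complex.Re (hdot H (abs_op T e) e))%:E)%E.

Definition reducing T K :=
  [/\ closed_subspace K, forall x, K x -> K (T x)
    & forall x, K x -> K (adjoint T x)].

Definition unitary_on T K := (forall x, K x -> `|T x| = `|x|) /\ T @` K = K.

(* For K reducing T, the subspaces reducing the restriction of T to K are the
   subspaces of K that reduce T. *)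
Definition cnu_on T K := forall L : set H,
  L `<=` K -> reducing T L -> unitary_on T L -> L = [set 0].

(* The unit circle is parametrized by t |-> exp(it), t in [0, 2 pi[; Lebesgue
   measure on the circle becomes Lebesgue measure on that interval. *)
Definition circle : set R := `[0, pi *+ 2[.

Definition orthogonal_projection P :=
  [/\ linear P, forall x : H, P (P x) = P x
    & forall x y : H, hdot H (P x) y = hdot H x (P y)].

(* E is the spectral measure of the restriction of T to K (a reducing subspace
   on which T is unitary). Each E A is extended by 0 to the orthogonal
   complement of K, so that E of the circle is the projection onto K; this
   forces E to vanish off [0, 2 pi[. The last clause says that
   A |-> <E(A) x, x> is a measure and <T x, x> = \int e^(it) d<E(t) x, x>. *)
Definition spectral_measure_on T K (E : set R -> H -> H) :=
  [/\ forall A : set R, measurable A ->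
        orthogonal_projection (E A) /\ (forall x, K (E A x)),
      forall x, K x -> E circle x = x,
      forall A B : set R, measurable A -> measurable B ->
        forall x, E (A `&` B) x = E A (E B x)
    & forall x, K x ->
        exists mu : {measure set (measurableTypeR R) -> \bar R},
          (forall A : set R, measurable A ->
             mu A = (complex.Re (hdot H (E A x) x))%:E) /\
          hdot H (T x) x = (\int[mu]_(t in circle) cos t)
                           +i* (\int[mu]_(t in circle) sin t)].

Definition ac_unitary_on T K := unitary_on T K /\
  exists E : set R -> H -> H, spectral_measure_on T K E /\
    forall A : set R, measurable A -> A `<=` circle ->
      lebesgue_measure A = 0%E -> forall x, E A x = 0.

Definition singular_unitary_on T K := unitary_on T K /\
  exists E : set R -> H -> H, spectral_measure_on T K E /\
    exists N : set R, [/\ measurable N, N `<=` circle,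
      lebesgue_measure N = 0%E & forall x, E (circle `\` N) x = 0].

Definition orthogonal_sum3 (K1 K2 K3 : set H) :=
  [/\ forall x y, K1 x -> K2 y -> hdot H x y = 0,
      forall x y, K1 x -> K3 y -> hdot H x y = 0,
      forall x y, K2 x -> K3 y -> hdot H x y = 0
    & forall x : H, exists x1 x2 x3 : H,
        [/\ K1 x1, K2 x2, K3 x3 & x = x1 + x2 + x3]].

Definition contraction_decomposition T (K1 Ka Ks : set H) :=
  [/\ reducing T K1 /\ cnu_on T K1,
      reducing T Ka /\ ac_unitary_on T Ka,
      reducing T Ks /\ singular_unitary_on T Ks
    & orthogonal_sum3 K1 Ka Ks].

(* The decomposition of a contraction is unique. *)
Definition absolutely_continuous T := exists K1 Ka : set H,
  contraction_decomposition T K1 Ka [set 0].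

End Operators.

Definition similar_op {R : realType} {H K : hilbertType R}
    (T : H -> H) (V : K -> K) :=
  exists (X : {linear H -> K}) (Y : {linear K -> H}),
    [/\ continuous X, continuous Y, cancel X Y, cancel Y X
      & forall x : H, X (T x) = V (X x)].

Definition similar_to_isometry {R : realType} {H : hilbertType R}
    (T : H -> H) :=
  exists (K : hilbertType R) (V : {linear K -> K}),
    (forall x : K, `|V x| = `|x|) /\ similar_op T V.

(* Main.v *)
From HB Require Import structures.
Require Import Defs.
From mathcomp Require Import all_boot all_order all_algebra.
From mathcomp Require Import sesquilinear complex.
From mathcomp Require Import all_classical all_reals all_analysis.
From mathcomp Require Import finmap ring.

Set Implicit Arguments.
Unset Strict Implicit.
Unset Printing Implicit Defensive.

Import Order.TTheory GRing.Theory Num.Theory.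
Import numFieldNormedType.Exports.

Local Open Scope classical_set_scope.
Local Open Scope complex_scope.
Local Open Scope ring_scope.

(** Let [X T = V X] with [V] an isometry, and let [A = b_l(T)]. The bound comes
    from counting dimensions, as in the proof of the Berger-Shaw inequality.

    Besides the inner product [t] of the space, consider the equivalent inner
    product [s x y = <X x, X y>], with [t <= a s] and [s <= b t]. For either of
    them, subtracting the square norm of [A x] from that of [x = y - l^* T y]
    gives [1 - |l|^2] times the same difference for [T y] and [y]
    ([moebius_sip]). Hence every [A] is a contraction for [t] and an isometry
    for [s], with constants [a] and [b] that do not depend on [l]. Moreover [T]
    is a Moebius transform of [A], so a closed subspace invariant under [A] is
    invariant under [T], and the vectors [g_1, ..., g_n] that are cyclic for [T]
    are cyclic for [A] ([krylov_moebius_dense]).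

    Let [M_N] be spanned by the first [N] of the vectors [A^k g_j], ordered by
    [k]. Then [A] maps [M_N] into [M_(N + n)]. Let [f] be an [s]-orthonormal basis
    of [M_(N + n)] whose first [N] vectors span [M_N]. As [A] is an
    [s]-isometry, the vectors [A f_j] with [j < N] are [s]-orthonormal in
    [M_(N + n)], and the sum of [t (f_j) - t (A f_j)] over [j < N] is at most the
    trace of [t] on the [s]-complement of [A M_N] in [M_(N + n)]. This complement
    has dimension at most [n], so the sum is at most [a n]: see
    [defect_trace_le]. The form [q = t - t (A _) (A _)] of [I - A^* A] thus has
    bounded traces on the [M_N] with respect to [s], therefore also with respect
    to [t] ([trace_compare]), and the union of the [M_N] is dense
    ([defect_sum_le]).

    It remains to identify the trace norm with a supremum of such finite sums:
    [I - A^* A] is positive, so it is its own absolute value. This needs the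
    existence of the adjoint ([riesz_representation]) and one half of the
    uniqueness of positive square roots ([positive_le_of_norm_eq]). *)

(** * Semi-inner products *)

Record semi_inner_product (C : numClosedFieldType) (V : lmodType C) :=
  SemiInnerProduct {
    sip :> V -> V -> C;
    sip_linear : forall a x y z, sip (a *: x + y) z = a * sip x z + sip y z;
    sipC : forall x y, sip y x = (sip x y)^*;
    sip_ge0 : forall x, 0 <= sip x x }.

Section Conjugate.
Context {C : numClosedFieldType}.
Implicit Types x y : C.

Lemma conjCD x y : (x + y)^* = x^* + y^*. Proof. exact: rmorphD. Qed.
Lemma conjCB x y : (x - y)^* = x^* - y^*. Proof. exact: rmorphB. Qed.
Lemma conjCM x y : (x * y)^* = x^* * y^*. Proof. exact: rmorphM. Qed.
Lemma conjCV x : (x^-1)^* = (x^*)^-1. Proof. exact: fmorphV. Qed.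

End Conjugate.

Section SemiInnerProduct.
Context {C : numClosedFieldType} {V : lmodType C}.
Implicit Types (s : semi_inner_product V) (x y z : V) (e : nat -> V).

Lemma sipDl s x y z : s (x + y) z = s x z + s y z.
Proof. by rewrite -[x]scale1r sip_linear mul1r scale1r. Qed.

Lemma sip0l s z : s 0 z = 0.
Proof. by apply: (addrI (s 0 z)); rewrite -sipDl !addr0. Qed.

Lemma sipZl s a x z : s (a *: x) z = a * s x z.
Proof. by rewrite -[a *: x]addr0 sip_linear sip0l addr0. Qed.

Lemma sipNl s x z : s (- x) z = - s x z.
Proof. by rewrite -scaleN1r sipZl mulN1r. Qed.

Lemma sipBl s x y z : s (x - y) z = s x z - s y z.
Proof. by rewrite sipDl sipNl. Qed.

Lemma sip_suml s (I : Type) (r : seq I) (P : pred I) (F : I -> V) z :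
  s (\sum_(i <- r | P i) F i) z = \sum_(i <- r | P i) s (F i) z.
Proof. by apply: (big_morph (s^~ z)) => [x y|]; rewrite ?sipDl ?sip0l. Qed.

Lemma sipDr s x y z : s z (x + y) = s z x + s z y.
Proof. by rewrite sipC sipDl rmorphD /= -!sipC. Qed.

Lemma sip0r s z : s z 0 = 0.
Proof. by rewrite sipC sip0l rmorph0. Qed.

Lemma sipZr s a x z : s z (a *: x) = a^* * s z x.
Proof. by rewrite sipC sipZl rmorphM /= -sipC. Qed.

Lemma sipNr s x z : s z (- x) = - s z x.
Proof. by rewrite sipC sipNl rmorphN /= -sipC. Qed.

Lemma sipBr s x y z : s z (x - y) = s z x - s z y.
Proof. by rewrite sipDr sipNr. Qed.

Lemma sip_sumr s (I : Type) (r : seq I) (P : pred I) (F : I -> V) z :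
  s z (\sum_(i <- r | P i) F i) = \sum_(i <- r | P i) s z (F i).
Proof. by apply: (big_morph (s z)) => [x y|]; rewrite ?sipDr ?sip0r. Qed.

Lemma sipMC s x y : s x y * s y x = `|s x y| ^+ 2.
Proof. by rewrite [s y x]sipC -normCK. Qed.

(** [b (x + y) (x + y) = 0] and [b (x + i y) (x + i y) = 0] give two independent
    equations in [b x y] and [b y x]. *)
Lemma sesquilinear_polarization (b : V -> V -> C) :
  (forall a x y z, b (a *: x + y) z = a * b x z + b y z) ->
  (forall a x y z, b z (a *: x + y) = a^* * b z x + b z y) ->
  (forall x, b x x = 0) -> forall x y, b x y = 0.
Proof.
move=> bl br b0 x y.
have e1 : b x y + b y x = 0.
  have := b0 (1 *: x + y); rewrite bl !br !b0 conjC1.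
  by move=> h; rewrite -[RHS]h; ring.
have e2 : 'i * (b y x - b x y) = 0.
  have := b0 ('i *: y + x); rewrite bl !br !b0 conjCi.
  by move=> h; rewrite -[RHS]h; ring.
move/eqP: e2; rewrite mulf_eq0 (negbTE (neq0Ci C)) /= subr_eq0 => /eqP yx.
by move/eqP: e1; rewrite yx -mulr2n mulrn_eq0 /= => /eqP.
Qed.

(** Expanding [0 <= s (s y y x - s x y y)] gives the inequality when
    [s y y != 0]; when both vectors are null, [x - s x y y] does. *)
Lemma sip_cauchy_schwarz s x y : `|s x y| ^+ 2 <= s x x * s y y.
Proof.
have main v u : s v v != 0 -> `|s u v| ^+ 2 <= s u u * s v v.
  move=> v0; have vp : 0 < s v v by rewrite lt_def v0 sip_ge0.
  have := sip_ge0 s (s v v *: u - s u v *: v).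
  rewrite !(sipBl, sipBr, sipZl, sipZr) -!sipC.
  rewrite (_ : _ - _ = s v v * (s u u * s v v - s u v * s v u)); last by ring.
  by rewrite pmulr_rge0 // subr_ge0 sipMC.
have [y0|/main//] := eqVneq (s y y) 0.
have [x0|/(main _ y)] := eqVneq (s x x) 0; last first.
  by rewrite mulrC [s y x]sipC norm_conjC.
have := sip_ge0 s (x - s x y *: y).
rewrite !(sipBl, sipBr, sipZl, sipZr) -!sipC x0 y0 !mulr0.
rewrite subr0 sub0r [s y x * _]mulrC sipMC -opprD -mulr2n oppr_ge0.
by rewrite -mulr_natr pmulr_lle0.
Qed.

Lemma sip_null s x y : s y y = 0 -> s x y = 0.
Proof.
move=> y0; have := sip_cauchy_schwarz s x y; rewrite y0 mulr0 => h.
by apply/eqP; rewrite -normr_eq0 -sqrf_eq0 eq_le h exprn_ge0.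
Qed.

Lemma sipD_null s x y : s x x = 0 -> s y y = 0 -> s (x + y) (x + y) = 0.
Proof. by move=> x0 y0; rewrite !(sipDl, sipDr) x0 y0 (sip_null _ x0) (sip_null _ y0) !addr0.
Qed.

Lemma sip_pythagoras s x y : s x y = 0 -> s (x + y) (x + y) = s x x + s y y.
Proof.
by move=> xy; rewrite sipDl !sipDr xy [s y x]sipC xy conjC0 addr0 add0r.
Qed.

Lemma sipD_le s x y : s (x + y) (x + y) <= s x x *+ 2 + s y y *+ 2.
Proof.
rewrite -subr_ge0.
rewrite (_ : _ - s (x + y) (x + y) = s (x - y) (x - y)) ?sip_ge0 //.
by rewrite !(sipBl, sipBr, sipDl, sipDr); ring.
Qed.

(** * Orthonormal systems with null vectors *)

(** Vectors of square norm [0] are allowed, so that orthonormalizing a linearly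
    dependent family does not change its length. *)
Definition orthonormal0 s p e :=
  (forall i j, (i < p)%N -> (j < p)%N -> i != j -> s (e i) (e j) = 0) /\
  (forall i, (i < p)%N -> s (e i) (e i) = 0 \/ s (e i) (e i) = 1).

Definition sip_proj s p e x := \sum_(i < p) s x (e i) *: e i.

Lemma sip_proj_linear s p e a x y :
  sip_proj s p e (a *: x + y) = a *: sip_proj s p e x + sip_proj s p e y.
Proof.
rewrite /sip_proj scaler_sumr -big_split; apply: eq_bigr => i _.
by rewrite sip_linear scalerDl scalerA.
Qed.

Lemma orthonormal0W s p q e : (p <= q)%N ->
  orthonormal0 s q e -> orthonormal0 s p e.
Proof.
move=> pq [eo en]; split=> [i j ip jp|i ip].
  by apply: eo; apply: leq_trans pq.
by apply: en; apply: leq_trans pq.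
Qed.

Section Projection.
Context {s : semi_inner_product V} {p : nat} {e : nat -> V}.
Hypothesis es : orthonormal0 s p e.
Local Notation P := (sip_proj s p e).

Lemma orthonormal0_le1 i : (i < p)%N -> s (e i) (e i) <= 1.
Proof. by case: es => _ /[apply] -[] ->; rewrite ?ler01. Qed.

Lemma sip_orthonormal0K i x : (i < p)%N -> s x (e i) * s (e i) (e i) = s x (e i).
Proof.
case: es => _ /[apply] -[h|->]; last by rewrite mulr1.
by rewrite h mulr0 sip_null.
Qed.

Lemma sip_comb_orthonormal0 (c : nat -> C) j : (j < p)%N ->
  s (\sum_(i < p) c i *: e i) (e j) = c j * s (e j) (e j).
Proof.
move=> jp; rewrite sip_suml (bigD1 (Ordinal jp)) //= big1 ?addr0 ?sipZl //.
by case: es => eo _ i ij; rewrite sipZl eo ?mulr0.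
Qed.

Lemma sip_projE x j : (j < p)%N -> s (P x) (e j) = s x (e j).
Proof.
by move=> jp; rewrite /sip_proj (sip_comb_orthonormal0 (s x \o e)) //=
  sip_orthonormal0K.
Qed.

Lemma sip_proj_orthogonal x y : s (x - P x) (P y) = 0.
Proof.
rewrite [P y]/sip_proj sip_sumr big1 // => i _.
by rewrite sipZr sipBl sip_projE // subrr mulr0.
Qed.

Lemma sip_proj_pythagoras x : s x x = s (x - P x) (x - P x) + s (P x) (P x).
Proof.
by rewrite -(sip_pythagoras (sip_proj_orthogonal x x)) subrK.
Qed.

Lemma sip_proj_norm x : s (P x) (P x) = \sum_(i < p) `|s x (e i)| ^+ 2.
Proof.
rewrite [in X in s _ X]/sip_proj sip_sumr; apply: eq_bigr => i _.
by rewrite sipZr sip_projE // mulrC normCK.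
Qed.

Lemma sip_bessel x : \sum_(i < p) `|s x (e i)| ^+ 2 <= s x x.
Proof. by rewrite (sip_proj_pythagoras x) -sip_proj_norm lerDr sip_ge0. Qed.

Lemma sip_parseval x : s (x - P x) (x - P x) = 0 ->
  s x x = \sum_(i < p) `|s x (e i)| ^+ 2.
Proof. by rewrite (sip_proj_pythagoras x) -sip_proj_norm => ->; rewrite add0r. Qed.

Lemma sip_proj_comb (c : nat -> C) (x := \sum_(i < p) c i *: e i) :
  s (x - P x) (x - P x) = 0.
Proof.
have xe j : (j < p)%N -> s (x - P x) (e j) = 0.
  by move=> jp; rewrite sipBl sip_projE // subrr.
rewrite sipBr sip_proj_orthogonal subr0 sip_sumr big1 // => i _.
by rewrite sipZr xe // mulr0.
Qed.

(** Up to the null vector [y - P y], the difference [x - y] is the sum of the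
    orthogonal vectors [x - P x] and [P (x - y)]. *)
Lemma sip_proj_best x y : s (y - P y) (y - P y) = 0 ->
  s (x - P x) (x - P x) <= s (x - y) (x - y).
Proof.
move=> y0; rewrite [leRHS]sip_proj_pythagoras.
have PB : P (x - y) = P x - P y.
  by rewrite -scaleN1r addrC sip_proj_linear scaleN1r addrC.
have -> : x - y - P (x - y) = (x - P x) - (y - P y).
  by rewrite PB !opprB [P y - P x]addrC addrACA [- y + P y]addrC.
rewrite ler_wpDr ?sip_ge0 //; move: (x - P x) (y - P y) y0 => r w w0.
rewrite sipBl !sipBr w0 (sip_null r w0) [s w r]sipC (sip_null r w0).
by rewrite conjC0 !subr0.
Qed.

Lemma sip_comb_le (c : nat -> C) (x := \sum_(i < p) c i *: e i) :
  s x x <= \sum_(i < p) `|c i| ^+ 2.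
Proof.
rewrite {2}/x sip_sumr; apply: ler_sum => i _.
rewrite sipZr sip_comb_orthonormal0 // mulrA [_^* * _]mulrC -normCK.
by rewrite ler_piMr ?exprn_ge0 // orthonormal0_le1.
Qed.

End Projection.

(** * Gram-Schmidt orthonormalization *)

Definition lspan (u : nat -> V) p x :=
  exists c : nat -> C, x = \sum_(i < p) c i *: u i.

Lemma lspan_linear u p a x y : lspan u p x -> lspan u p y ->
  lspan u p (a *: x + y).
Proof.
move=> [c ->] [d ->]; exists (fun i => a * c i + d i).
rewrite scaler_sumr -big_split; apply: eq_bigr => i _.
by rewrite scalerDl scalerA.
Qed.

Lemma lspan0 u p : lspan u p 0.
Proof. by exists (fun=> 0); rewrite big1 // => i _; rewrite scale0r. Qed.

Lemma lspanZ u p a x : lspan u p x -> lspan u p (a *: x).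
Proof. by move=> ux; rewrite -[_ *: _]addr0; apply/lspan_linear/lspan0. Qed.

Lemma lspan_sum u p q (F : nat -> V) :
  (forall i, (i < q)%N -> lspan u p (F i)) -> lspan u p (\sum_(i < q) F i).
Proof.
move=> h; elim/big_ind : _ => [|x y ux uy|i _]; [exact: lspan0| |exact: h].
by rewrite -[x]scale1r; apply: lspan_linear.
Qed.

Lemma lspan_gen u p i : (i < p)%N -> lspan u p (u i).
Proof.
move=> ip; exists (fun j => (j == i)%:R).
rewrite (bigD1 (Ordinal ip)) //= eqxx scale1r big1 ?addr0 // => j ji.
case: eqP => [ij|]; last by rewrite scale0r.
by case/eqP: ji; apply: val_inj.
Qed.

Lemma lspanW u p q x : (p <= q)%N -> lspan u p x -> lspan u q x.
Proof.
move=> pq [c ->]; apply: (@lspan_sum u q p (fun i => c i *: u i)) => i ip.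
by apply/lspanZ/lspan_gen/(leq_trans ip).
Qed.

(** The same [e] serves for the whole flag of spans of initial segments of [u]:
    the trace of a defect over the [N]-th subspace is computed inside a later
    one. *)
Lemma gram_schmidt s (u : nat -> V) p : exists e,
  [/\ orthonormal0 s p e,
      forall j, (j < p)%N -> lspan u j.+1 (e j)
    & forall N j (v := u j - sip_proj s N e (u j)),
        (j < N)%N -> (N <= p)%N -> s v v = 0].
Proof.
elim: p => [|p [e [es eu ue]]].
  exists (fun=> 0); split=> [|//|N j v jN]; first by split.
  by rewrite leqn0 => /eqP N0; rewrite N0 in jN.
pose r := u p - sip_proj s p e (u p).
pose v := if s r r == 0 then 0 else (sqrtC (s r r))^-1 *: r.
pose e' j := if j == p then v else e j.
have e'p : e' p = v by rewrite /e' eqxx.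
have e'E j : (j < p)%N -> e' j = e j by rewrite /e'; case: ltngtP.
have re j : (j < p)%N -> s r (e j) = 0.
  by move=> jp; rewrite sipBl (sip_projE es) // subrr.
have ve j : (j < p)%N -> s v (e j) = 0.
  by move=> jp; rewrite /v; case: ifP => _; rewrite ?sip0l // sipZl re // mulr0.
have ev j : (j < p)%N -> s (e j) v = 0 by move=> jp; rewrite sipC ve ?conjC0.
have sq : s r r != 0 -> sqrtC (s r r) != 0 by rewrite sqrtC_eq0.
have sqr : (sqrtC (s r r))^* = sqrtC (s r r).
  by apply: geC0_conj; rewrite sqrtC_ge0 sip_ge0.
have vv : s v v = 0 \/ s v v = 1.
  rewrite /v; case: ifPn => [_|r0]; first by left; rewrite sip0l.
  right; rewrite sipZl sipZr fmorphV /= sqr -{3}[s r r]sqrtCK expr2.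
  by rewrite mulrA; field; rewrite sq.
have projS x : sip_proj s p.+1 e' x = sip_proj s p e x + s x v *: v.
  rewrite /sip_proj big_ord_recr /= e'p; congr (_ + _).
  by apply: eq_bigr => i _; rewrite e'E.
have proj_v x : s (sip_proj s p e x) v = 0.
  by rewrite /sip_proj sip_suml big1 // => i _; rewrite sipZl ev ?mulr0.
exists e'; split.
- split=> [i j|i]; rewrite !ltnS leq_eqVlt.
    case/predU1P => [->|ip]; rewrite leq_eqVlt => /predU1P[->|jp].
    + by rewrite eqxx.
    + by move=> _; rewrite e'p e'E // ve.
    + by move=> _; rewrite e'p e'E // ev.
    + by case: es => es _; rewrite !e'E //; exact: es.
  case/predU1P => [->|ip]; first by rewrite e'p.
  by rewrite e'E //; case: es => _; exact.
- move=> j; rewrite ltnS leq_eqVlt => /predU1P[->|jp]; last first.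
    by rewrite e'E //; exact: eu.
  rewrite e'p /v; case: ifP => _; first exact: lspan0.
  apply/lspanZ; rewrite /r addrC -scaleN1r; apply: lspan_linear.
    apply: (@lspan_sum u p.+1 p (fun i => s (u p) (e i) *: e i)) => i ip.
    by apply/lspanZ/(lspanW _ (eu i ip)); rewrite ltnS ltnW.
  exact: lspan_gen.
- move=> N j w jN; rewrite leq_eqVlt ltnS => /predU1P[Np|Np]; last first.
    rewrite /w (_ : sip_proj s N e' _ = sip_proj s N e (u j)) ?ue //.
    by apply: eq_bigr => i _; rewrite e'E // (leq_trans (ltn_ord i)).
  rewrite {}/w; move: jN; rewrite Np ltnS projS opprD addrA {Np}.
  have uv : s (u j - sip_proj s p e (u j)) v = s (u j) v.
    by rewrite sipBl proj_v subr0.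
  rewrite leq_eqVlt => /predU1P[ij|jp]; last first.
    have h := ue p j jp (leqnn p); rewrite -uv [s _ v]sipC (sip_null _ h) conjC0 scale0r subr0.
    exact: h.
  move: uv; rewrite ij -/r => <-.
  have [r0|r0] := eqVneq (s r r) 0.
    have -> : v = 0 by rewrite /v r0 eqxx.
    by rewrite scaler0 subr0.
  have -> : v = (sqrtC (s r r))^-1 *: r by rewrite /v (negbTE r0).
  rewrite sipZr fmorphV /= sqr scalerA (_ : _ * _ = 1); last first.
    by rewrite -{2}[s r r]sqrtCK expr2; field; rewrite sq.
  by rewrite scale1r subrr sip0l.
Qed.

Lemma gram_schmidt_span s (u : nat -> V) p e x :
  (forall j (v := u j - sip_proj s p e (u j)), (j < p)%N -> s v v = 0) ->
  lspan u p x -> let v := x - sip_proj s p e x in s v v = 0.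
Proof.
move=> ue [c ->] /=.
elim/big_ind : _ => [|y z y0 z0|i _].
- by rewrite /sip_proj big1 ?subr0 ?sip0l // => i _; rewrite sip0l scale0r.
- have -> : sip_proj s p e (y + z) = sip_proj s p e y + sip_proj s p e z.
    by rewrite -[y]scale1r sip_proj_linear !scale1r.
  by rewrite opprD addrACA; apply: sipD_null.
- have -> : sip_proj s p e (c i *: u i) = c i *: sip_proj s p e (u i).
    rewrite /sip_proj scaler_sumr; apply: eq_bigr => j _.
    by rewrite sipZl scalerA.
  by rewrite -scalerBr sipZl sipZr ue ?mulr0.
Qed.

End SemiInnerProduct.

(** * The trace of the defect on a finite-dimensional subspace *)

Section Trace.
Context {C : numClosedFieldType} {V : lmodType C}.
Implicit Types (s t q : semi_inner_product V) (x y z : V).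

Lemma linear_comb (L : V -> V) p (c : nat -> C) (f : nat -> V) : linear L ->
  L (\sum_(i < p) c i *: f i) = \sum_(i < p) c i *: L (f i).
Proof.
move=> Ll; have L0 : L 0 = 0.
  by apply: (addrI (L 0)); rewrite -{1}[L 0]scale1r -Ll scaler0 !addr0.
by elim/big_rec2 : _ => [//|i y1 y2 _ <-]; rewrite Ll.
Qed.

Section TraceSplit.
Context {s t : semi_inner_product V} {p N : nat} {f g : nat -> V}.
Hypothesis gs : orthonormal0 s N g.
Hypothesis gf : forall j, (j < N)%N -> g j = sip_proj s p f (g j).
Hypothesis gK : forall j, (j < N)%N -> sip_proj s N g (g j) = g j.
Local Notation Q := (sip_proj s N g).

(** Both sides are the trace of the form [t (L _) _] on the span of [g]: the sum
    over [f] does not see the complement of this span, which [Q] kills. *)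
Lemma trace_exchange (L : V -> V) : linear L ->
  \sum_(i < p) t (L (f i)) (Q (f i)) = \sum_(j < N) t (L (g j)) (g j).
Proof.
move=> Ll.
under eq_bigr do rewrite [in X in t _ X]/sip_proj sip_sumr.
rewrite exchange_big; apply: eq_bigr => j _ /=.
rewrite [in X in t X _]gf // [in RHS]/sip_proj.
rewrite (linear_comb p (fun i => s (g j) (f i))) // sip_suml.
by apply: eq_bigr => i _; rewrite sipZl sipZr -sipC.
Qed.

(** The trace of [t] on the span of [f] is the sum of its traces on the span of
    [g] and on the [s]-complement of that span; [trace_exchange] makes the
    off-diagonal terms vanish. *)
Lemma trace_split : \sum_(i < p) t (f i) (f i) =
  \sum_(i < p) t (f i - Q (f i)) (f i - Q (f i)) + \sum_(j < N) t (g j) (g j).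
Proof.
have Ql : linear Q by move=> a x y; rewrite sip_proj_linear.
have Rl : linear (fun x => x - Q x).
  by move=> a x y; rewrite Ql opprD addrACA scalerBr.
have -> : \sum_(j < N) t (g j) (g j) = \sum_(i < p) t (Q (f i)) (Q (f i)).
  by rewrite (trace_exchange Ql); apply: eq_bigr => j _; rewrite gK.
have cross : \sum_(i < p) t (f i - Q (f i)) (Q (f i)) = 0.
  by rewrite (trace_exchange Rl) big1 // => j _; rewrite gK // subrr sip0l.
have cross' : \sum_(i < p) t (Q (f i)) (f i - Q (f i)) = 0.
  under eq_bigr do rewrite sipC.
  by rewrite -rmorph_sum /= cross conjC0.
transitivity (\sum_(i < p) (t (f i - Q (f i)) (f i - Q (f i)) +
  t (Q (f i)) (Q (f i)) + t (f i - Q (f i)) (Q (f i)) +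
  t (Q (f i)) (f i - Q (f i)))); last first.
  by rewrite !big_split /= cross cross' !addr0.
apply: eq_bigr => i _; move: (Q (f i)) => y.
by rewrite !(sipBl, sipBr); ring.
Qed.

End TraceSplit.

(** By [trace_split], the left-hand side is at most the trace of [t] on the
    [s]-complement of the span of the [A (f j)] in the span of [f]. Applied to
    [s] itself, the same identity bounds the dimension of this complement by
    [n]. *)
Lemma defect_trace_le s t (A : {linear V -> V}) (a : C) N n (f : nat -> V) :
  (forall x, s x x = 0 -> x = 0) ->
  (forall x, t x x <= a * s x x) ->
  (forall x y, s (A x) (A y) = s x y) ->
  orthonormal0 s (N + n) f ->
  (forall j, (j < N)%N -> A (f j) = sip_proj s (N + n) f (A (f j))) ->
  0 <= a ->
  \sum_(j < N) (t (f j) (f j) - t (A (f j)) (A (f j))) <= a * n%:R.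
Proof.
move=> s_def ts As fs fA a0; pose g j := A (f j).
have gs : orthonormal0 s N g.
  case: fs => fo fn; split=> [i j iN jN|i iN]; rewrite As.
    by apply: fo; rewrite ltn_addr.
  by apply: fn; rewrite ltn_addr.
have gK j : (j < N)%N -> sip_proj s N g (g j) = g j.
  move=> jN; have [c gE] := lspan_gen g jN.
  apply/esym/eqP; rewrite -subr_eq0; apply/eqP/s_def.
  by rewrite gE (sip_proj_comb gs).
have split_t := trace_split (t := t) fA gK.
have split_s := trace_split (t := s) fA gK.
set z := fun i : nat => f i - sip_proj s N g (f i).
have zs : \sum_(i < N + n) s (z i) (z i) <= n%:R.
  have -> : \sum_(i < N + n) s (z i) (z i) =
      \sum_(i < n) s (f (N + i)%N) (f (N + i)%N).
    apply: (addIr (\sum_(j < N) s (g j) (g j))); rewrite -split_s.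
    rewrite big_split_ord /= addrC; congr (_ + _).
    by apply: eq_bigr => j _; rewrite As.
  apply: (@le_trans _ _ (\sum_(i < n) 1)).
    by apply: ler_sum => i _; rewrite (orthonormal0_le1 fs) // ltn_add2l.
  by rewrite sumr_const card_ord.
apply: (@le_trans _ _ (\sum_(i < N + n) t (z i) (z i))).
  rewrite sumrB lerBlDr -split_t big_split_ord /= lerDl.
  by apply: sumr_ge0 => i _; exact: sip_ge0.
apply: (@le_trans _ _ (a * \sum_(i < N + n) s (z i) (z i))).
  by rewrite mulr_sumr; apply: ler_sum => i _; exact: ts.
by rewrite ler_wpM2l.
Qed.

(** * Comparison of traces for two inner products *)

(** The map from coefficients [c] to [\sum_k c k *: h k] has norm at most
    [sqrt b] into the space with norm [s], and so has its adjoint, which sends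
    [w] to the coefficients [s w (h k)]. *)
Lemma bessel_dual s t (b : C) m (h : nat -> V) w :
  0 <= b -> orthonormal0 t m h -> (forall x, s x x <= b * t x x) ->
  \sum_(k < m) `|s (h k) w| ^+ 2 <= b * s w w.
Proof.
move=> b0 ht st; set S := \sum_(k < m) _.
have S0 : 0 <= S by apply: sumr_ge0 => k _; rewrite exprn_ge0.
pose v := \sum_(k < m) (s (h k) w)^* *: h k.
have vw : s v w = S.
  by rewrite sip_suml; apply: eq_bigr => k _; rewrite sipZl mulrC normCK.
have vt : t v v <= S.
  apply: le_trans (sip_comb_le ht (fun k => (s (h k) w)^*)) _.
  by apply: ler_sum => k _; rewrite norm_conjC.
have := sip_cauchy_schwarz s v w; rewrite vw (ger0_norm S0) => CS.
have {CS} : S * S <= S * (b * s w w).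
  rewrite -expr2 (le_trans CS) // mulrCA mulrA ler_wpM2r ?sip_ge0 //.
  by rewrite (le_trans (st v)) // ler_wpM2l.
have [->|Sn0] := eqVneq S 0; first by rewrite mulr_ge0 ?sip_ge0.
by rewrite ler_pM2l // lt_def Sn0.
Qed.

(** Gram-Schmidt for [q] itself writes [q x x] as the sum of the
    [`|q x (e l)| ^+ 2], so that the claim reduces to forms of rank one, where it
    is [bessel_dual]. *)
Lemma trace_compare s t q (b : C) m N (h f : nat -> V) :
  0 <= b -> orthonormal0 t m h -> (forall x, s x x <= b * t x x) ->
  orthonormal0 s N f ->
  \sum_(k < m) q (sip_proj s N f (h k)) (sip_proj s N f (h k)) <=
  b * \sum_(j < N) q (f j) (f j).
Proof.
move=> b0 ht st fs; have [e [eq _ fe]] := gram_schmidt q f N.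
pose w l := \sum_(j < N) (q (f j) (e l))^* *: f j.
have hw k l : q (sip_proj s N f (h k)) (e l) = s (h k) (w l).
  rewrite sip_suml sip_sumr; apply: eq_bigr => j _.
  by rewrite sipZl sipZr conjCK mulrC.
apply: (@le_trans _ _ (\sum_(l < N) \sum_(k < m) `|s (h k) (w l)| ^+ 2)).
  rewrite exchange_big /=; apply: ler_sum => k _.
  rewrite (sip_parseval eq); first by apply: ler_sum => l _; rewrite hw.
  apply: gram_schmidt_span => [j v jN|]; first exact: (fe _ _ jN (leqnn _)).
  by exists (fun j => s (h k) (f j)).
apply: (@le_trans _ _ (\sum_(l < N) b * \sum_(j < N) `|q (f j) (e l)| ^+ 2)).
  apply: ler_sum => l _; apply: le_trans (bessel_dual _ b0 ht st) _.
  rewrite ler_wpM2l // (le_trans (sip_comb_le fs (fun j => (q (f j) (e l))^*))) //.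
  by apply: ler_sum => j _; rewrite norm_conjC.
rewrite -mulr_sumr ler_wpM2l // exchange_big /=.
by apply: ler_sum => j _; exact: sip_bessel.
Qed.

(** The family [h] is replaced with its [s]-projections on the span of the first
    [N] vectors of [u], to which [trace_compare] and [defect_trace_le] apply; the
    error is controlled by any [x] in that span. *)
Lemma defect_sum_le s t q (A : {linear V -> V}) (a b : C) n (u : nat -> V)
    N m (h x : nat -> V) :
  0 <= a -> 0 <= b ->
  (forall y, t y y = 0 -> y = 0) ->
  (forall y, t y y <= a * s y y) -> (forall y, s y y <= b * t y y) ->
  (forall y z, s (A y) (A z) = s y z) ->
  (forall y, q y y = t y y - t (A y) (A y)) ->
  (forall i, A (u i) = u (i + n)%N) ->
  orthonormal0 t m h -> (forall k, (k < m)%N -> lspan u N (x k)) ->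
  \sum_(k < m) q (h k) (h k) <=
  (b * (a * n%:R)) *+ 2 + (a * b * \sum_(k < m) t (h k - x k) (h k - x k)) *+ 2.
Proof.
move=> a0 b0 t_def ts st As qE Au ht ux.
have s_def y : s y y = 0 -> y = 0.
  move=> y0; apply/t_def/le_anti; rewrite sip_ge0 andbT.
  by rewrite (le_trans (ts y)) // y0 mulr0.
have [f [fs fu uf]] := gram_schmidt s u (N + n).
have fs' : orthonormal0 s N f := orthonormal0W (leq_addr n N) fs.
pose P := sip_proj s N f.
have tr : \sum_(j < N) q (f j) (f j) <= a * n%:R.
  under eq_bigr do rewrite qE.
  apply: (defect_trace_le s_def ts As fs _ a0) => j jN.
  apply/eqP; rewrite -subr_eq0; apply/eqP/s_def.
  apply: (@gram_schmidt_span _ _ s u) => [i v iN|]; first exact: (uf _ _ iN (leqnn _)).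
  have [c ->] := fu j (ltn_addr _ jN); rewrite linear_sum.
  apply: (@lspan_sum _ _ u (N + n) j.+1 (fun i => A (c i *: u i))) => i ij.
  by rewrite linearZ Au; apply/lspanZ/lspan_gen; rewrite ltn_add2r (leq_trans ij).
have xP k : (k < m)%N -> s (x k - P (x k)) (x k - P (x k)) = 0.
  move=> km; apply: (@gram_schmidt_span _ _ s u) => [i v iN|]; last exact: ux.
  exact: (uf _ _ iN (leq_addr _ _)).
have qt y : q y y <= t y y by rewrite qE gerBl sip_ge0.
apply: (@le_trans _ _ (\sum_(k < m)
    (q (P (h k)) (P (h k)) *+ 2 + (a * (b * t (h k - x k) (h k - x k))) *+ 2))).
  apply: ler_sum => k _; rewrite -[in leLHS](subrKC (P (h k)) (h k)).
  apply: le_trans (sipD_le _ _ _) _; rewrite lerD2l lerMn2r /=.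
  apply: le_trans (qt _) (le_trans (ts _) _); rewrite ler_wpM2l //.
  exact: le_trans (sip_proj_best fs' _ (xP _ (ltn_ord k))) (st _).
rewrite big_split /= !sumrMnl; apply: lerD; rewrite lerMn2r /=.
  by apply: le_trans (trace_compare q b0 ht st fs') _; rewrite ler_wpM2l.
by rewrite -!mulr_sumr mulrA.
Qed.

End Trace.

(** * Hilbert spaces *)

Lemma real_ReK (R : realType) (x : R[i]) : x \is Num.real ->
  (complex.Re x)%:C = x.
Proof. by case: x => a b; rewrite complex_real => /eqP /= ->. Qed.

(** Norms and inner products take their values in [R[i]], whose order is
    partial; this transports the suprema of [R] to sets of real elements. *)
Lemma csup_adherent (R : realType) (S : set R[i]) (M : R[i]) :
  S !=set0 -> (forall x, S x -> x \is Num.real) -> (forall x, S x -> x <= M) ->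
  exists b : R[i], [/\ b \is Num.real, forall x, S x -> x <= b
    & forall e, 0 < e -> exists2 x, S x & b - e < x].
Proof.
move=> [x0 Sx0] Sr SM; pose E := [set complex.Re x | x in S].
have Eb : has_sup E.
  split; first by exists (complex.Re x0), x0.
  exists (complex.Re M) => _ [x Sx <-].
  by have := SM x Sx; rewrite lecE => /andP[].
exists (sup E)%:C; split; first by rewrite complex_real.
- move=> x Sx; rewrite -(real_ReK (Sr x Sx)) lecR.
  by apply: (sup_upper_bound Eb); exists x.
- move=> e e0; have er : e \is Num.real by rewrite ger0_real // ltW.
  have : 0 < complex.Re e by rewrite -ltcR real_ReK.
  case/(sup_adherent)/(_ Eb) => _ [x Sx <-] h; exists x => //.
  by rewrite -(real_ReK (Sr x Sx)) -(real_ReK er) -rmorphB ltcR.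
Qed.

Section HilbertSpace.
Context {R : realType}.
Local Notation C := R[i].

Section Dot.
Context (H : hilbertType R).

Lemma hdot_linear (a : C) (x y z : H) :
  hdot H (a *: x + y) z = a * hdot H x z + hdot H y z.
Proof. exact: linearPl. Qed.

Lemma hdotC (x y : H) : hdot H y x = (hdot H x y)^*.
Proof. by rewrite hermC /= expr0 mul1r. Qed.

Lemma hdot_ge0 (x : H) : 0 <= hdot H x x.
Proof. by rewrite -hdot_norm exprn_ge0. Qed.

Definition hsip : semi_inner_product H :=
  SemiInnerProduct hdot_linear hdotC hdot_ge0.

Lemma hsipE (x : H) : hsip x x = `|x| ^+ 2.
Proof. by rewrite hdot_norm. Qed.

Lemma hsip_def (x : H) : hsip x x = 0 -> x = 0.
Proof. by rewrite hsipE => /eqP; rewrite sqrf_eq0 normr_eq0 => /eqP. Qed.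

Lemma hsip_le (x y : H) : `|hsip x y| <= `|x| * `|y|.
Proof.
rewrite -(ler_pXn2r (ltn0Sn 1)) ?nnegrE ?mulr_ge0 //.
by rewrite exprMn -!hsipE sip_cauchy_schwarz.
Qed.

End Dot.

(** Completeness in the form used to solve equations: [G e] collects the
    solutions up to an error [e], and these approximate solutions are close to
    each other. *)
Lemma complete_approx (H : hilbertType R) (L : set H) (G : C -> set H) :
  closed L ->
  (forall e d, e <= d -> G e `<=` G d) ->
  (forall e, 0 < e -> exists2 z, L z & G e z) ->
  (forall e d z w, G e z -> G d w -> `|z - w| <= e + d) ->
  exists2 z, L z & forall e, 0 < e -> exists2 w, G e w & `|z - w| < e.
Proof.
move=> Lc Gm Gn Gd.
pose F := filter_from [set e : C | 0 < e] (fun e => L `&` G e).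
have FF : Filter F.
  apply: filter_from_filter; first by exists 1; rewrite /= ltr01.
  move=> e d /= e0 d0.
  have [ed|de] := real_leP (gtr0_real e0) (gtr0_real d0).
    by exists e => // z [Lz Gz]; split; split => //; apply: Gm ed _ Gz.
  by exists d => // z [Lz Gz]; split; split => //; apply: Gm (ltW de) _ Gz.
have PF : ProperFilter F.
  by apply: filter_from_proper => e /= /Gn[z Lz Gz]; exists z.
have Fc : cauchy F.
  apply/cauchy_ballP => e e0; have e3 : 0 < e / 3 by rewrite divr_gt0.
  exists (L `&` G (e / 3), L `&` G (e / 3)); first by split; exists (e / 3).
  move=> [z w] /= [[_ Gz] [_ Gw]]; rewrite -ball_normE /=.
  apply: le_lt_trans (Gd _ _ _ _ Gz Gw) _.
  rewrite -subr_gt0 (_ : _ - _ = e / 3) //; by field.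
have : cvg F by exact: cauchy_cvg.
set z := lim F => Fz; exists z.
  apply: (@closed_cvg _ _ F _ id L Lc _ z Fz).
  by exists 1; [rewrite /= ltr01 | move=> ? []].
move=> e e0; have /(Fz _) [d d0 Bd] := nbhsx_ballx z e e0.
have [ed|de] := real_leP (gtr0_real e0) (gtr0_real d0).
  have [w Lw Gw] := Gn e e0; exists w => //.
  have := Bd w; rewrite -ball_normE; apply; split=> //; exact: Gm ed _ Gw.
have [w Lw Gw] := Gn d d0; exists w; first exact: Gm (ltW de) _ Gw.
by have := Bd w; rewrite -ball_normE; apply.
Qed.

End HilbertSpace.

(** * Solving equations by approximation *)

Section Solve.
Context {R : realType}.
Local Notation C := R[i].

Lemma norm_small_eq0 (V : normedZmodType C) (v : V) (k : C) : 0 <= k ->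
  (forall e, 0 < e -> `|v| <= k * e) -> v = 0.
Proof.
move=> k0 h; apply/eqP; rewrite -normr_eq0; apply/eqP.
have k1 : 0 < k + 1 by rewrite ltr_wpDl.
have [//|v0] := eqVneq `|v| 0.
have vp : 0 < `|v| by rewrite lt_def v0 normr_ge0.
have := h _ (divr_gt0 vp k1); rewrite mulrA ler_pdivlMr // mulrC.
by rewrite ler_pM2r // gerDl ler10.
Qed.

Lemma addC_le_norm (z : C) : z + z^* <= `|z| *+ 2.
Proof.
have zr : z + z^* \is Num.real.
  by apply/CrealP; rewrite conjCD conjCK addrC.
apply: le_trans (real_ler_norm zr) (le_trans (ler_normD _ _) _).
by rewrite norm_conjC mulr2n.
Qed.


(** The functional [phi] is represented up to [e] by any [z] that minimizes
    [|x|^2 - 2 Re (phi x)] up to [e^2]; completeness does the rest. *)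
Lemma riesz_representation (H : hilbertType R) (phi : H -> C) (M : C) :
  0 <= M -> (forall a x y, phi (a *: x + y) = a * phi x + phi y) ->
  (forall x, `|phi x| <= M * `|x|) ->
  exists z, forall x, phi x = hsip H x z.
Proof.
move=> M0 phil phiM.
have phi0 : phi 0 = 0.
  by apply/eqP; rewrite -normr_le0 (le_trans (phiM 0)) // normr0 mulr0.
pose J x := phi x + (phi x)^* - hsip H x x.
have Jr x : J x \is Num.real.
  apply: realB; last by rewrite ger0_real ?sip_ge0.
  by apply/CrealP; rewrite conjCD conjCK addrC.
have JM x : J x <= M ^+ 2.
  rewrite lerBlDr (le_trans (addC_le_norm _)) //.
  apply: (@le_trans _ _ (M * `|x| *+ 2)); first by rewrite lerMn2r phiM.
  rewrite hsipE -subr_ge0 (_ : _ - _ = (M - `|x|) ^+ 2); last by ring.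
  by rewrite real_exprn_even_ge0 // realB // ger0_real.
have [b [_ Jb Ja]] : exists b : C, [/\ b \is Num.real,
    forall x, [set J x | x in setT] x -> x <= b
    & forall e, 0 < e -> exists2 x, [set J x | x in setT] x & b - e < x].
  apply: (@csup_adherent _ _ (M ^+ 2)); first by exists (J 0), 0.
    by move=> _ [x _ <-].
  by move=> _ [x _ <-].
pose G (e : C) : set H :=
  [set z | 0 <= e /\ forall x, `|phi x - hsip H x z| <= e * `|x|].
suff [z _ Gz] : exists2 z, setT z &
    forall e, 0 < e -> exists2 w, G e w & `|z - w| < e.
  exists z => x; apply/eqP; rewrite -subr_eq0; apply/eqP.
  apply: (norm_small_eq0 (k := `|x| *+ 2)) => [|e e0].
    by rewrite mulrn_wge0.
  have [w [_ Gw] zw] := Gz e e0.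
  rewrite (_ : _ - _ = (phi x - hsip H x w) - hsip H x (z - w)).
    apply: le_trans (ler_normB _ _) _; rewrite mulrnAl mulr2n lerD //.
      by rewrite mulrC Gw.
    by rewrite (le_trans (hsip_le _ _)) // ler_wpM2l // ltW.
  by rewrite sipBr; ring.
apply: complete_approx => [|e d ed z [e0 Gz]|e e0|e d z w [e0 Gz] [d0 Gw]].
- exact: closedT.
- split=> [|x]; first exact: le_trans ed.
  by rewrite (le_trans (Gz x)) // ler_wpM2r.
- have [_ [z _ <-] zb] := Ja _ (exprn_gt0 2 e0); exists z => //.
  split=> [|x]; first exact: ltW.
  have [->|x0] := eqVneq x 0; first by rewrite phi0 sip0l subrr !normr0 mulr0.
  have xx0 : 0 < hsip H x x by rewrite hsipE exprn_gt0 // normr_gt0.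
  rewrite -(ler_pXn2r (ltn0Sn 1)) ?nnegrE ?mulr_ge0 ?(ltW e0) //.
  rewrite exprMn -hsipE normCK -ler_pdivrMr //.
  set d := phi x - _; pose a := d^* / hsip H x x.
  have ac : a^* = d / hsip H x x.
    by rewrite conjCM conjCK conjCV -sipC.
  have : J (a *: x + z) < J z + e ^+ 2.
    by rewrite -ltrBlDr (le_lt_trans _ zb) // lerD2r Jb //; exists (a *: x + z).
  rewrite -subr_gt0 (_ : _ - _ = e ^+ 2 - d * d^* / hsip H x x).
    by rewrite subr_gt0 => /ltW.
  rewrite /J phil !(sipDl, sipDr, sipZl, sipZr) conjCD conjCM ac.
  have -> : phi x = d + hsip H x z by rewrite subrK.
  rewrite conjCD -[(hsip H x z)^*]sipC /a; field.
  by rewrite gt_eqF.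
- have [->|v0] := eqVneq (z - w) 0; first by rewrite normr0 addr_ge0.
  rewrite -(ler_pM2r (_ : 0 < `|z - w|)) ?normr_gt0 // -expr2 -hsipE.
  rewrite -[leLHS]ger0_norm ?sip_ge0 //.
  rewrite (_ : hsip H (z - w) (z - w) = (phi (z - w) - hsip H (z - w) w) -
      (phi (z - w) - hsip H (z - w) z)); last by rewrite [LHS]sipBr; ring.
  rewrite mulrDl; apply: le_trans (ler_normB _ _) _.
  by rewrite [leRHS]addrC lerD.
Qed.

(** The infimum of the residuals [|z - c S z - x|] over [L] is [0], because
    adding the residual to [z] multiplies it by at most [|c| < 1]. *)
Lemma contraction_solve (H : hilbertType R) (L : set H) (S : H -> H) (c : C) x :
  closed_subspace L -> linear S -> (forall z, L z -> L (S z)) ->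
  (forall z, `|S z| <= `|z|) -> `|c| < 1 -> L x ->
  exists2 z, L z & z - c *: S z = x.
Proof.
move=> [[L0 Ll] Lc] Sl LS Sc c1 Lx.
have c1' : 0 < 1 - `|c| by rewrite subr_gt0.
pose r z := x - (z - c *: S z).
have LD z w : L z -> L w -> L (z + w).
  by move=> Lz Lw; rewrite -[z]scale1r; exact: Ll.
have LZ a z : L z -> L (a *: z).
  by move=> Lz; rewrite -[a *: z]addr0; exact: Ll.
have Lr z : L z -> L (r z).
  move=> Lz; rewrite /r opprB; apply/LD/LD => //; first exact/LZ/LS.
  by rewrite -scaleN1r; exact: LZ.
have SD z w : S (z + w) = S z + S w.
  by rewrite -{1}[z]scale1r Sl scale1r.
have rE z w : r (z + w) = r z - (w - c *: S w).
  by rewrite /r SD scalerDr [- (_ *: _ + _)]opprD addrACA opprD addrA.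
have rr z : r (z + r z) = c *: S (r z).
  by rewrite rE opprB addrCA subrr addr0.
have [b [br rb ra]] : exists b : C, [/\ b \is Num.real,
    forall a, [set - `|r z| | z in L] a -> a <= b
    & forall e, 0 < e -> exists2 a, [set - `|r z| | z in L] a & b - e < a].
  apply: (@csup_adherent _ _ 0); first by exists (- `|r 0|), 0.
    by move=> _ [z _ <-]; rewrite realN ger0_real.
  by move=> _ [z _ <-]; rewrite oppr_le0.
have b0 : 0 <= b.
  rewrite real_leNgt ?real0 //; apply/negP => b0.
  have m0 : 0 < - b by rewrite oppr_gt0.
  (* at this precision, one more step would beat the infimum *)
  have [_ [z Lz <-]] := ra _ (mulr_gt0 m0 c1').
  rewrite ltrNr opprB => rz.
  have : - `|r (z + r z)| <= b.
    by apply: rb; exists (z + r z) => //; apply/LD/Lr.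
  rewrite rr normrZ lerNl => h.
  have : - b <= `|c| * (- b * (1 - `|c|) - b).
    by rewrite (le_trans h) // ler_wpM2l // (le_trans (Sc _)) // ltW.
  rewrite -subr_ge0 (_ : _ - _ = - (- b * (1 - `|c|) ^+ 2)); last by ring.
  by rewrite oppr_ge0 => /le_gtF; rewrite mulr_gt0 // exprn_gt0.
have r_small e : 0 < e -> exists2 z, L z & `|r z| < e.
  move=> /ra[_ [z Lz <-]]; rewrite ltrNr opprB => h.
  by exists z => //; rewrite (lt_le_trans h) // gerBl.
suff [z Lz Gz] : exists2 z, L z & forall e, 0 < e ->
    exists2 w, 0 <= e /\ `|r w| <= (1 - `|c|) * e & `|z - w| < e.
  exists z => //; apply/eqP; rewrite -subr_eq0 -opprB oppr_eq0; apply/eqP.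
  apply: (norm_small_eq0 (k := 1 - `|c| + 2)) => [|e e0].
    by rewrite addr_ge0 // ltW.
  have [w [_ rw] zw] := Gz e e0.
  have -> : x - (z - c *: S z) = r w - ((z - w) - c *: S (z - w)).
    by rewrite -rE subrKC.
  rewrite mulrDl (le_trans (ler_normB _ _)) // lerD //.
  rewrite (le_trans (ler_normB _ _)) // mulr_natl mulr2n lerD ?(ltW zw) //.
  rewrite normrZ (le_trans _ (ltW zw)) // (le_trans (ler_piMl _ (ltW c1))) //.
apply: (@complete_approx _ _ L
  (fun e : C => [set w | 0 <= e /\ `|r w| <= (1 - `|c|) * e])) => //.
- move=> e d ed z [e0 rz]; split; first exact: le_trans ed.
  by rewrite (le_trans rz) // ler_wpM2l // ltW.
- move=> e e0; have [z Lz rz] := r_small _ (mulr_gt0 c1' e0).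
  by exists z => //; split; exact: ltW.
- move=> e d z w [e0 rz] [d0 rw]; rewrite -(ler_pM2l c1') mulrDr.
  rewrite (le_trans _ (lerD rz rw)) // (le_trans _ (ler_normB _ _)) //.
  have -> : r z - r w = - ((z - w) - c *: S (z - w)).
    by rewrite -[in r z](subrKC w z) rE addrAC subrr sub0r.
  rewrite normrN (le_trans _ (lerB_dist _ _)) // mulrBl mul1r lerB //.
  by rewrite normrZ ler_wpM2l.
Qed.

End Solve.

(** * Positive square roots *)

Section SquareRoot.
Context {R : realType} {H : hilbertType R}.
Local Notation C := R[i].
Local Notation t := (hsip H).

(** Polarization: the numbers [<P x, x>] determine the form, so their being
    real makes it hermitian. *)
Lemma positive_op_hermitian (P : H -> H) x y :
  linear P -> positive_op P -> t (P y) x = (t (P x) y)^*.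
Proof.
move=> Pl P0; apply/eqP; rewrite -subr_eq0; apply/eqP; move: y x.
apply: sesquilinear_polarization => [a x y z|a x y z|x].
- by rewrite Pl !(sip_linear, sipDr, sipZr) conjCD conjCM conjCK; ring.
- by rewrite Pl !(sip_linear, sipDr, sipZr) conjCD conjCM; ring.
- by rewrite geC0_conj ?subrr //; exact: P0.
Qed.

(** Uniqueness of positive square roots, one inequality at a time. Suppose
    that [p - q] takes a positive value at some unit vector, and let [b] be its
    supremum there. The hypothesis [|P x| = |D x|] says that
    [Re <(P - D) x, (P + D) x> = 0]; at a unit vector where [p - q] almost
    attains [b], [(P - D) x] is almost [b x], whence
    [b <(P + D) x, x>] is almost [0], although [<(P + D) x, x>] is at least
    [<(P - D) x, x>], which is almost [b]. *)
Lemma positive_le_of_norm_eq (P D : H -> H) (p q : semi_inner_product H)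
    (M : C) :
  (forall x y, t (P x) y = p x y) -> (forall x y, t (D x) y = q x y) ->
  (forall x, `|P x| = `|D x|) -> 0 <= M -> (forall x, `|P x| <= M * `|x|) ->
  forall x, p x x <= q x x.
Proof.
move=> pE qE PD M0 PM x0.
have rl x : p x x - q x x \is Num.real.
  by rewrite realB // ger0_real // sip_ge0.
rewrite -subr_le0 real_leNgt ?real0 ?rl //; apply/negP => x0p.
have p_le x : p x x <= M * `|x| ^+ 2.
  rewrite -pE -[leLHS]ger0_norm ?pE ?sip_ge0 // -pE (le_trans (hsip_le _ _)) //.
  by rewrite expr2 mulrA ler_wpM2r.
have q_le x : q x x <= M * `|x| ^+ 2.
  rewrite -qE -[leLHS]ger0_norm ?qE ?sip_ge0 // -qE (le_trans (hsip_le _ _)) //.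
  by rewrite expr2 mulrA ler_wpM2r // -PD.
pose U := [set x : H | `|x| = 1].
have x00 : x0 != 0 by apply: contraTneq x0p => ->; rewrite !sip0l subrr ltxx.
have n0 : `|x0| != 0 by rewrite normr_eq0.
have scale x : x != 0 -> U (`|x|^-1 *: x).
  move=> xn0; rewrite /U /= normrZ normfV normr_id mulVf //.
  by rewrite normr_eq0.
have sc (s : semi_inner_product H) x :
    s (`|x|^-1 *: x) (`|x|^-1 *: x) = (`|x|^-1) ^+ 2 * s x x.
  have a0 : (`|x|^-1 : C)^* = `|x|^-1 by apply: geC0_conj; rewrite invr_ge0.
  by rewrite sipZl sipZr a0 mulrA expr2.
have [b [br bP ba]] : exists b : C, [/\ b \is Num.real,
    forall a, [set p x x - q x x | x in U] a -> a <= b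
    & forall e, 0 < e -> exists2 a, [set p x x - q x x | x in U] a & b - e < a].
  apply: (@csup_adherent _ _ M).
  - by exists (p (`|x0|^-1 *: x0) (`|x0|^-1 *: x0) -
      q (`|x0|^-1 *: x0) (`|x0|^-1 *: x0)), (`|x0|^-1 *: x0) => //; exact: scale.
  - by move=> _ [x _ <-].
  - move=> _ [x x1 <-]; rewrite lerBlDr (le_trans (p_le x)) // x1 expr1n mulr1.
    by rewrite lerDl sip_ge0.
have b0 : 0 < b.
  apply: lt_le_trans (bP _ _); last first.
    by exists (`|x0|^-1 *: x0); [exact: scale|].
  by rewrite !sc -mulrBr mulr_gt0 // exprn_gt0 // invr_gt0 lt_def n0 normr_ge0.
have Ege x : 0 <= b * t x x - p x x + q x x.
  have [->|xn0] := eqVneq x 0; first by rewrite !sip0l mulr0 subrr addr0.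
  have : p (`|x|^-1 *: x) (`|x|^-1 *: x) - q (`|x|^-1 *: x) (`|x|^-1 *: x) <= b.
    by apply: bP; exists (`|x|^-1 *: x); first exact: scale.
  rewrite !sc -mulrBr exprVn mulrC ler_pdivrMr; last first.
    by rewrite exprn_gt0 // normr_gt0.
  by rewrite hsipE -subr_ge0 opprB addrA addrAC.
have El a x y z : b * t (a *: x + y) z - p (a *: x + y) z + q (a *: x + y) z =
    a * (b * t x z - p x z + q x z) + (b * t y z - p y z + q y z).
  by rewrite !sip_linear; ring.
have EC x y : b * t y x - p y x + q y x = (b * t x y - p x y + q x y)^*.
  by rewrite conjCD conjCB conjCM -!sipC (CrealP br).
pose E := SemiInnerProduct El EC Ege.
pose K := (b + M) * (M *+ 2) ^+ 2.
have K0 : 0 <= K.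
  by rewrite mulr_ge0 ?exprn_ge0 ?mulrn_wge0 // addr_ge0 // ltW.
have key e : 0 < e -> e <= b / 2 -> (b ^+ 2 / 2) ^+ 2 <= e * K.
  move=> e0 eb; have [_ [x x1 <-] xe] := ba e e0.
  have Ex : E x x <= e.
    have -> : E x x = b * t x x - p x x + q x x by [].
    rewrite hsipE x1 expr1n mulr1 -addrA [- _ + _]addrC -opprB.
    by rewrite lerBlDr -lerBlDl ltW.
  pose y := P x + D x.
  have yM : `|y| <= M *+ 2.
    rewrite (le_trans (ler_normD _ _)) // mulr2n lerD //.
      by rewrite (le_trans (PM x)) // x1 mulr1.
    by rewrite -PD (le_trans (PM x)) // x1 mulr1.
  have Ey : E y y <= K.
    apply: (@le_trans _ _ (b * `|y| ^+ 2 + M * `|y| ^+ 2)).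
      rewrite (_ : E y y = b * t y y - p y y + q y y) // hsipE lerD ?q_le //.
      by rewrite gerBl sip_ge0.
    by rewrite -mulrDl ler_wpM2l ?addr_ge0 ?(ltW b0) // lerXn2r ?nnegrE ?mulrn_wge0.
  apply: le_trans (_ : `|E x y| ^+ 2 <= _); last first.
    by apply: le_trans (sip_cauchy_schwarz _ _ _) _; rewrite ler_pM ?sip_ge0.
  have ReE : E x y + (E x y)^* = (b * (p x x + q x x)) *+ 2.
    have xP : t x (P x) = p x x by rewrite sipC pE -sipC.
    have xD : t x (D x) = q x x by rewrite sipC qE -sipC.
    have PPDD : t (P x) (P x) = t (D x) (D x) by rewrite !hsipE PD.
    have -> : E x y = b * (p x x + q x x) - t (P x) (D x) + t (D x) (P x).
      rewrite (_ : E x y = b * t x y - p x y + q x y) // -pE -qE !sipDr.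
      by rewrite xP xD PPDD; ring.
    rewrite conjCD conjCB conjCM conjCD (CrealP br) -!sipC.
    by ring.
  rewrite lerXn2r ?nnegrE ?divr_ge0 ?exprn_ge0 ?(ltW b0) //.
  have := addC_le_norm (E x y); rewrite ReE lerMn2r /=; apply: le_trans.
  rewrite expr2 -mulrA ler_pM2l // (@le_trans _ _ (b - e)) //.
    by rewrite lerBrDr -lerBrDl (le_trans eb) // {2}[b](splitr) addrK.
  rewrite (le_trans (ltW xe)) // lerD2l.
  by rewrite (@le_trans _ _ 0) ?oppr_le0 ?sip_ge0.
(* [e = b^4 / d] is at most [b / 2], and [e K < b^4 / 4], contrary to [key] *)
pose d := b ^+ 3 *+ 2 + K *+ 4 + 4.
have d1 : 0 < b ^+ 3 *+ 2 + 4 by rewrite ltr_pwDr ?mulrn_wge0 ?exprn_ge0 // ltW.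
have d0 : 0 < d by rewrite /d addrAC ltr_pwDl // mulrn_wge0.
have e0 : 0 < b ^+ 4 / d by rewrite divr_gt0 // exprn_gt0.
have : (b ^+ 2 / 2) ^+ 2 <= b ^+ 4 / d * K.
  apply: key => //; rewrite ler_pdivrMr // -subr_ge0.
  rewrite (_ : _ - _ = b * (K *+ 2 + 2)).
    by rewrite mulr_ge0 ?(ltW b0) // addr_ge0 // mulrn_wge0.
  by rewrite /d; field.
rewrite -subr_ge0 (_ : _ - _ = - (b ^+ 4 / (d * 4) * (b ^+ 3 *+ 2 + 4))).
  rewrite oppr_ge0 => /le_gtF; rewrite mulr_gt0 // divr_gt0 ?exprn_gt0 //.
  by rewrite mulr_gt0.
have -> : b ^+ 3 *+ 2 + 4 = d - K *+ 4 by rewrite /d; ring.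
by field; rewrite gt_eqF.
Qed.


End SquareRoot.

(** * The trace norm of the defect *)

Lemma linear_continuous_bound (R : realType) (U V : normedModType R[i])
    (f : {linear U -> V}) : continuous f ->
  exists2 M : R[i], 0 <= M & forall x, `|f x| <= M * `|x|.
Proof.
move=> /(_ 0) /(continuous_linear_bounded 0) /linear_boundedP fb.
near (pinfty_nbhs R[i]) => M; exists M; last by near: M.
near: M; exact: nbhs_pinfty_ge.
Unshelve. all: by end_near. Qed.

Section TraceNorm.
Context {R : realType} {H : hilbertType R}.
Local Notation C := R[i].
Local Notation t := (hsip H).

Lemma adjointE (A : H -> H) x y :
  linear A -> contraction_op A -> t (A x) y = t x (adjoint A y).
Proof.
move=> Al Ac; have [z Az] : exists z, forall x, t (A x) y = t x z.
  apply: (@riesz_representation _ _ _ `|y|) => [//|a u v|u].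
    by rewrite Al sip_linear.
  by rewrite (le_trans (hsip_le _ _)) // mulrC ler_wpM2l.
have : [set z : H | forall x : H, hdot H (A x) y = hdot H x z] (adjoint A y).
  by apply: xgetPex; exists z.
exact.
Qed.

Lemma adjoint_unique (D : H -> H) y z :
  (forall x, t (D x) y = t x z) -> adjoint D y = z.
Proof.
move=> Dz; have : forall x, t (D x) y = t x (adjoint D y).
  suff : [set z : H | forall x : H, hdot H (D x) y = hdot H x z] (adjoint D y).
    by exact.
  by apply: xgetPex; exists z.
move=> Da; apply/eqP; rewrite -subr_eq0; apply/eqP/hsip_def.
by rewrite sipBr -Da -Dz subrr.
Qed.

Lemma defectE (A : H -> H) x y : linear A -> contraction_op A ->
  t (defect A x) y = t x y - t (A x) (A y).
Proof.
move=> Al Ac; rewrite /defect sipBl; congr (_ - _).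
by rewrite sipC -adjointE // -sipC.
Qed.

(** The inequality also holds for the default value [0] of [abs_op], so that the
    existence of the square root is not at stake. *)
Lemma abs_op_defect_le (A : H -> H) (q : semi_inner_product H) x :
  (forall x y, t (defect A x) y = q x y) ->
  complex.Re (hdot H (abs_op (defect A) x) x) <= complex.Re (q x x).
Proof.
set D := defect A => qE; have Re_le (a b : C) : a <= b -> complex.Re a <= complex.Re b.
  by rewrite lecE => /andP[].
apply: Re_le; rewrite -[hdot H _ _]/(t _ _) /abs_op.
case: xgetP => [P _ [Pl Pc P0 PP]|_]; last by rewrite sip0l sip_ge0.
have Plt a y z w : t (P (a *: y + z)) w = a * t (P y) w + t (P z) w.
  by rewrite Pl sip_linear.
pose p := SemiInnerProduct Plt
  (fun y z => positive_op_hermitian y z Pl P0) P0.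
pose Pp := GRing.isLinear.Build _ _ _ _ P Pl.
pose PL : {linear H -> H} := HB.pack P Pp.
have [M M0 PM] := @linear_continuous_bound _ _ _ PL Pc.
have adjD y : adjoint D y = D y.
  by apply: adjoint_unique => z; rewrite qE [RHS]sipC qE -sipC.
apply: (@positive_le_of_norm_eq _ _ P D p q M) => // y.
apply/eqP; rewrite -(eqrXn2 (ltn0Sn 1)) // -!hsipE; apply/eqP.
rewrite -[LHS]/(p y (P y)) sipC -[p _ _]/(t (P (P y)) y) PP adjD qE.
by rewrite -sipC -qE.
Qed.

Lemma trace_norm_defect_le (A : H -> H) (q : semi_inner_product H) (B : R) :
  (forall x y, t (defect A x) y = q x y) -> 0 <= B ->
  (forall m (h : nat -> H), orthonormal0 t m h ->
    \sum_(k < m) q (h k) (h k) <= B%:C) ->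
  (trace_norm (defect A) <= B%:E)%E.
Proof.
move=> qE B0 qB; rewrite /trace_norm.
case: xgetP => [E _ [E1 Eo _]|_]; last by rewrite esum_set0 lee_fin.
apply: ge_ereal_sup => _ [F [Ff FE] <-].
rewrite fsbig_finite //= sumEFin lee_fin.
set r := (finmap.enum_fset _).
have rE e : e \in r -> E e.
  move=> er; apply: FE; have : e \in fset_set F by exact: er.
  by rewrite in_fset_set // => /set_mem.
have ru : uniq r by exact: finmap.fset_uniq.
have h_on : orthonormal0 t (size r) (nth 0 r).
  split=> [i j ir jr ij|i ir]; last first.
    by right; rewrite hsipE E1 ?expr1n //; apply/rE/mem_nth.
  apply: Eo; [exact/rE/mem_nth|exact/rE/mem_nth|].
  by apply/eqP; rewrite nth_uniq.
apply: (@le_trans _ _ (\sum_(e <- r) complex.Re (q e e))).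
  by apply: ler_sum => e _; exact: abs_op_defect_le.
have := qB _ _ h_on; rewrite lecE => /andP[_]; rewrite raddf_sum /=.
by rewrite (big_nth 0) big_mkord.
Qed.

End TraceNorm.

(** * Moebius transforms of a contraction *)

Section Moebius.
Context {R : realType} {H : hilbertType R}.
Local Notation C := R[i].
Local Notation t := (hsip H).

Lemma contraction_inj (S : H -> H) (c : C) y z :
  linear S -> contraction_op S -> `|c| < 1 ->
  y - c *: S y = z - c *: S z -> y = z.
Proof.
move=> Sl Sc c1 yz; apply/eqP; rewrite -subr_eq0.
pose v := y - z; have vE : v = c *: S v.
  have SB : S v = S y - S z by rewrite /v addrC -scaleN1r Sl scaleN1r addrC.
  rewrite SB scalerBr /v -[in LHS](subrK (c *: S y) y) yz.
  by rewrite addrAC [z - _ - z]addrAC subrr sub0r addrC.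
rewrite -/v -normr_le0; have : `|v| <= `|c| * `|v|.
  by rewrite {1}vE normrZ ler_wpM2l.
rewrite -subr_le0 -{1}(mul1r `|v|) -mulrBl pmulr_rle0 //.
by rewrite subr_gt0.
Qed.

Lemma setT_closed_subspace : closed_subspace [set: H].
Proof. by split; [split|exact: closedT]. Qed.

Context {T : {linear H -> H}} {l : C}.
Hypothesis Tc : contraction_op T.
Hypothesis l1 : `|l| < 1.

Let lc1 : `|l^*| < 1. Proof. by rewrite norm_conjC. Qed.

Lemma moebius_onto x : exists y, x = y - l^* *: T y.
Proof.
have [z _ zx] := @contraction_solve _ _ setT T l^* x setT_closed_subspace
  (@linearP _ _ _ _ T) (fun _ _ => I) Tc lc1 I.
by exists z.
Qed.

Lemma moebiusE y : moebius T l (y - l^* *: T y) = T y - l *: y.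
Proof.
rewrite /moebius; set z := op_inverse _ _.
suff -> : z = y by [].
apply: (contraction_inj (@linearP _ _ _ _ T) Tc lc1).
have : [set w : H | w - l^* *: T w = y - l^* *: T y] z.
  by apply: xgetPex; exists y.
exact.
Qed.

Lemma moebius_linear : linear (moebius T l).
Proof.
move=> a x1 x2; have [y1 ->] := moebius_onto x1.
have [y2 ->] := moebius_onto x2.
have -> : a *: (y1 - l^* *: T y1) + (y2 - l^* *: T y2) =
    (a *: y1 + y2) - l^* *: T (a *: y1 + y2).
  by rewrite linearP scalerBr scalerDr opprD addrACA !scalerA mulrC.
rewrite !moebiusE linearP scalerBr scalerDr opprD addrACA !scalerA.
by rewrite [l * a]mulrC.
Qed.

Lemma moebius_sip (s : semi_inner_product H) y (x := y - l^* *: T y) :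
  s x x - s (moebius T l x) (moebius T l x) =
  (1 - l * l^*) * (s y y - s (T y) (T y)).
Proof.
rewrite moebiusE /x; move: (T y) => z.
by rewrite !(sipBl, sipBr, sipZl, sipZr) conjCK; ring.
Qed.

Lemma moebius_contraction : contraction_op (moebius T l).
Proof.
move=> x; have [y xy] := moebius_onto x.
rewrite -(ler_pXn2r (ltn0Sn 1)) ?nnegrE // -subr_ge0 -!hsipE xy moebius_sip.
rewrite mulr_ge0 // subr_ge0; first by rewrite -normCK expr_le1 // ltW.
by rewrite !hsipE lerXn2r ?nnegrE.
Qed.

Lemma moebius_isometry (s : semi_inner_product H) x :
  (forall y, s (T y) (T y) = s y y) ->
  s (moebius T l x) (moebius T l x) = s x x.
Proof.
move=> sT; have [y xy] := moebius_onto x; apply/esym/eqP.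
by rewrite -subr_eq0 xy moebius_sip sT subrr mulr0.
Qed.

(** [T] is recovered from [A = b_l(T)] by the inverse Moebius transform
    [(A + l) (1 + l^* A)^-1], and the inverse exists on [L] itself. *)
Lemma moebius_invariant (L : set H) :
  closed_subspace L -> (forall x, L x -> L (moebius T l x)) ->
  forall x, L x -> L (T x).
Proof.
move=> Lc LA x Lx; have [[L0 Ll] _] := Lc.
have LZ a z : L z -> L (a *: z).
  by move=> Lz; rewrite -[a *: z]addr0; exact: Ll.
have k0 : 1 - l * l^* != 0.
  by rewrite gt_eqF // subr_gt0 -normCK expr_lt1.
have [w Lw wx] := @contraction_solve _ _ L (moebius T l) (- l^*)
  ((1 - l * l^*) *: x) Lc moebius_linear LA moebius_contraction
  (eq_ind_r (fun u => u < 1) lc1 (normrN _)) (LZ _ _ Lx).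
have wE : w = x - l^* *: T x.
  apply: (contraction_inj moebius_linear moebius_contraction
    (eq_ind_r (fun u => u < 1) lc1 (normrN _))).
  rewrite wx moebiusE !scaleNr opprK scalerBr scalerA addrA subrK.
  by rewrite scalerBl scale1r mulrC.
have -> : T x = l *: x + moebius T l w.
  by rewrite wE moebiusE addrC subrK.
exact/Ll/LA.
Qed.

End Moebius.

(** * Closed invariant subspaces *)

Section Closure.
Context {R : realType} {H : hilbertType R}.
Local Notation C := R[i].

Lemma closure_normP (K : set H) x :
  closure K x <-> forall e : C, 0 < e -> exists2 y, K y & `|x - y| < e.
Proof.
split=> [Kx e e0|Kx B /nbhs_ballP[e e0 eB]].
  have [y [Ky]] := Kx _ (nbhsx_ballx x e e0).
  by rewrite -ball_normE => xy; exists y.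
have [y Ky xy] := Kx e e0; exists y; split=> //.
by apply: eB; rewrite -ball_normE.
Qed.

Lemma closure_subspace (K : set H) :
  linear_subspace K -> closed_subspace (closure K).
Proof.
move=> [K0 Kl]; split; last exact: closed_closure.
split=> [|a x y /closure_normP Kx /closure_normP Ky].
  exact: subset_closure.
apply/closure_normP => e e0.
have a1 : 0 < `|a| + 1 by rewrite ltr_wpDl.
have [x' Kx' xx'] := Kx _ (divr_gt0 e0 a1).
have [y' Ky' yy'] := Ky _ (divr_gt0 e0 a1).
exists (a *: x' + y'); first exact: Kl.
rewrite opprD addrACA -scalerBr (le_lt_trans (ler_normD _ _)) // normrZ.
rewrite -[e](divfK (lt0r_neq0 a1)) [ltRHS]mulrC mulrDl mul1r ler_ltD //.
by rewrite ler_wpM2l // ltW.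
Qed.

Lemma closure_invariant (K : set H) (A : H -> H) :
  linear A -> contraction_op A -> (forall x, K x -> closure K (A x)) ->
  forall x, closure K x -> closure K (A x).
Proof.
move=> Al Ac KA x /closure_normP Kx; apply/closure_normP => e e0.
have e2 : 0 < e / 2 by rewrite divr_gt0.
have [y Ky xy] := Kx _ e2; have /closure_normP/(_ _ e2)[z Kz yz] := KA y Ky.
exists z => //; rewrite -(subrK (A y) (A x)) -addrA.
have -> : A x - A y = A (x - y) by rewrite addrC -scaleN1r -Al scaleN1r addrC.
rewrite [e]splitr (le_lt_trans (ler_normD _ _)) // ler_ltD //.
by rewrite (le_trans (Ac _)) // ltW.
Qed.

End Closure.

Section Krylov.
Context {R : realType} {H : hilbertType R}.
Local Notation C := R[i].
Local Notation t := (hsip H).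

(** The vectors [A^k g_j], for [j < n], in the order of [k], so that [A] shifts
    the sequence by [n]. *)
Definition krylov (A : H -> H) n (g : nat -> H) i : H :=
  iter (i %/ n) A (g (i %% n)%N).

Lemma krylov_shift (A : H -> H) n (g : nat -> H) i : (0 < n)%N ->
  A (krylov A n g i) = krylov A n g (i + n)%N.
Proof. by move=> n0; rewrite /krylov modnDr divnDr // divnn n0 addn1. Qed.

Lemma lspan_subspace (u : nat -> H) :
  linear_subspace [set x | exists N, lspan u N x].
Proof.
split; first by exists 0%N; exact: lspan0.
move=> a x y [N Nx] [M My]; exists (N + M)%N.
by apply: lspan_linear; [apply: lspanW Nx|apply: lspanW My];
  rewrite ?leq_addr ?leq_addl.
Qed.

Lemma closure_krylov_invariant (A : {linear H -> H}) n (g : nat -> H)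
    (L := closure [set x | exists N, lspan (krylov A n g) N x]) :
  (0 < n)%N -> contraction_op A -> forall x, L x -> L (A x).
Proof.
move=> n0 Ac x; apply: (closure_invariant (@linearP _ _ _ _ A) Ac).
move=> {}x [N [c ->]]; apply: subset_closure; exists (N + n)%N.
rewrite linear_sum.
apply: (@lspan_sum _ _ _ (N + n) N (fun i => A (c i *: krylov A n g i))).
move=> i iN; rewrite linearZ krylov_shift //.
by apply/lspanZ/lspan_gen; rewrite ltn_add2r.
Qed.

Lemma krylov_moebius_dense (T : {linear H -> H}) (l : C) (A : {linear H -> H})
    (E : set H) n (g : nat -> H) :
  contraction_op T -> `|l| < 1 -> moebius T l = A -> (0 < n)%N ->
  E `<=` lspan g n -> cyclic_subspace T E ->
  closure [set x | exists N, lspan (krylov A n g) N x] = setT.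
Proof.
move=> Tc l1 AE n0 Eg Tcyc; set L := closure _.
have Lc : closed_subspace L by exact/closure_subspace/lspan_subspace.
have Ac : contraction_op A by rewrite -AE; exact: moebius_contraction.
have LT : forall x, L x -> L (T x).
  apply: (moebius_invariant Tc l1 Lc) => x; rewrite AE.
  exact: closure_krylov_invariant.
have EL : E `<=` L.
  move=> x /Eg[c ->]; apply: subset_closure; exists n.
  apply: (@lspan_sum _ _ _ n n (fun i => c i *: g i)) => i iN; apply: lspanZ.
  have -> : g i = krylov A n g i by rewrite /krylov divn_small // modn_small.
  exact: lspan_gen.
rewrite -subTset -Tcyc; apply: smallest_sub => // _ [k _ [x Ex <-]].
by elim: k => [|k IH] /=; [exact: EL|exact: LT].
Qed.

End Krylov.

(** * The uniform bound *)

Section Bound.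
Context {R : realType} {H : hilbertType R}.
Local Notation C := R[i].
Local Notation t := (hsip H).

(** [defect_sum_le] for an orthonormal family of [m] vectors, approximated within
    [1 / (m + 1)] by vectors of the Krylov spaces, which makes the error term at
    most [1]. *)
Lemma trace_norm_defect_bound (s : semi_inner_product H) (a b : C) n
    (g : nat -> H) (A : {linear H -> H}) :
  0 <= a -> 0 <= b -> (0 < n)%N ->
  (forall y, t y y <= a * s y y) -> (forall y, s y y <= b * t y y) ->
  (forall y, s (A y) (A y) = s y y) -> contraction_op A ->
  closure [set x | exists N, lspan (krylov A n g) N x] = setT ->
  (trace_norm (defect A) <=
    (complex.Re ((b * (a * n%:R)) *+ 2 + (a * b) *+ 2))%:E)%E.
Proof.
move=> a0 b0 n0 ts st As Ac dense.
have As' y z : s (A y) (A z) = s y z.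
  apply/eqP; rewrite -subr_eq0; apply/eqP; move: y z.
  apply: sesquilinear_polarization => [c x y z|c x y z|x].
  - by rewrite linearP !sip_linear; ring.
  - by rewrite linearP !(sipDr, sipZr); ring.
  - by rewrite As subrr.
have ql c x y z : t (c *: x + y) z - t (A (c *: x + y)) (A z) =
    c * (t x z - t (A x) (A z)) + (t y z - t (A y) (A z)).
  by rewrite linearP !sip_linear; ring.
have qC x y : t y x - t (A y) (A x) = (t x y - t (A x) (A y))^*.
  by rewrite conjCB -!sipC.
have q0 x : 0 <= t x x - t (A x) (A x).
  by rewrite subr_ge0 !hsipE lerXn2r ?nnegrE.
pose q := SemiInnerProduct ql qC q0.
set B := _ + _; have B0 : 0 <= B.
  by rewrite addr_ge0 // mulrn_wge0 // !mulr_ge0.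
have BE : (complex.Re B)%:C = B by rewrite real_ReK // ger0_real.
apply: (@trace_norm_defect_le _ _ A q).
- by move=> x y; rewrite defectE //; exact: linearP.
- by rewrite -lecR BE.
- move=> m h h_on; rewrite BE.
  pose e : C := (m.+1%:R)^-1; have e0 : 0 < e by rewrite invr_gt0 ltr0Sn.
  have app k : exists x, (exists N, lspan (krylov A n g) N x) /\
      `|h k - x| < e.
    have : closure [set x | exists N, lspan (krylov A n g) N x] (h k).
      by rewrite dense.
    by move=> /closure_normP/(_ _ e0)[x Nx hx]; exists x.
  have [x xh] := choice app.
  have [N uN] : exists N, forall k, (k < m)%N -> lspan (krylov A n g) N (x k).
    have [M uM] := choice (fun k => (xh k).1).
    exists (\max_(k < m) M k)%N => k km; apply: lspanW (uM k).
    exact: (@leq_bigmax _ (fun k : 'I_m => M k) (Ordinal km)).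
  apply: le_trans (defect_sum_le a0 b0 (@hsip_def _ _) ts st As' (q := q) _ _ h_on uN) _.
  - by [].
  - by move=> i; exact: krylov_shift.
  rewrite /B lerD2l lerMn2r /= ler_piMr ?mulr_ge0 //.
  apply: (@le_trans _ _ (\sum_(k < m) e)).
    apply: ler_sum => k _; rewrite -hdot_norm.
    have e1 : e <= 1 by rewrite invf_le1 ?ler1n ?ltr0Sn.
    have [_ /ltW xe] := xh k; rewrite (le_trans _ xe) // expr2 ler_piMr //.
    exact: le_trans e1.
  rewrite sumr_const card_ord -[e *+ m]mulr_natl /e ler_pdivrMr ?ltr0Sn // mul1r.
  by rewrite ler_nat.
Qed.

End Bound.

Theorem theorem2p1 (R : realType) (H : hilbertType R) (T : {linear H -> H})
    (T_contr : contraction_op T)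
    (T_ac : absolutely_continuous T)
    (T_mult : (op_multiplicity T < +oo)%E)
    (T_sim : similar_to_isometry T) :
  (ereal_sup [set trace_norm (defect (moebius T l))
             | l in [set l : R[i] | (`|l| < 1)%R]] < +oo)%E.
Proof.
have [E [n [v [vE Ecyc]]]] : exists E n (v : 'I_n -> H),
    E = [set x | exists c : 'I_n -> R[i], x = \sum_(i < n) c i *: v i] /\
    cyclic_subspace T E.
  case/ereal_inf_lt: T_mult => _ [E [_ Ec] <-].
  by case/ereal_inf_lt => _ [n [v [_ vE]] _] _; exists E, n, v.
pose g j := if insub j is Some i then v i else 0.
(* one null generator is added, so that there is at least one *)
have Eg : E `<=` lspan g n.+1.
  rewrite vE => _ [c ->].
  elim/big_ind : _ => [|x y gx gy|i _]; first exact: lspan0.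
    by rewrite -[x]scale1r; exact: lspan_linear.
  have -> : v i = g i by rewrite /g valK.
  by apply/lspanZ/lspan_gen; rewrite ltnS ltnW.
case: T_sim => K [V [V_iso [X [Y [Xc Yc XK YK XT]]]]].
have [MX MX0 XM] := linear_continuous_bound Xc.
have [MY MY0 YM] := linear_continuous_bound Yc.
have sl a x y z : hsip K (X (a *: x + y)) (X z) =
    a * hsip K (X x) (X z) + hsip K (X y) (X z).
  by rewrite linearP sip_linear.
pose s := SemiInnerProduct sl (fun x y => sipC (hsip K) (X x) (X y))
  (fun x => sip_ge0 (hsip K) (X x)).
have sE x : s x x = `|X x| ^+ 2 by exact: hsipE.
have sT y : s (T y) (T y) = s y y by rewrite !sE XT V_iso.
pose a := MY ^+ 2; pose b := MX ^+ 2.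
have ts y : hsip H y y <= a * s y y.
  rewrite hsipE sE -exprMn lerXn2r ?nnegrE ?mulr_ge0 //.
  by rewrite -{1}(XK y).
have st y : s y y <= b * hsip H y y.
  by rewrite hsipE sE -exprMn lerXn2r ?nnegrE ?mulr_ge0.
pose B := complex.Re ((b * (a * n.+1%:R)) *+ 2 + (a * b) *+ 2).
apply: (@le_lt_trans _ _ B%:E); last by rewrite ltry.
apply: ge_ereal_sup => _ [l /= l1 <-].
pose A_lin := GRing.isLinear.Build _ _ _ _ (moebius T l) (moebius_linear T_contr l1).
pose A : {linear H -> H} := HB.pack (moebius T l) A_lin.
have AE : moebius T l = A by [].
rewrite AE; apply: (@trace_norm_defect_bound _ _ s _ _ _ g) => //.
- exact: exprn_ge0.
- exact: exprn_ge0.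
- by move=> y; rewrite -AE; exact: moebius_isometry.
- by rewrite -AE; exact: moebius_contraction.
- exact: (krylov_moebius_dense T_contr l1 AE _ Eg Ecyc).
Qed.
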